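(* Let $n\in\mathbb{Z}$, $n\ge 1$, and let $b_n=[z^n]f_1(z)$, where $f_1(z)=e^{x}E_1(x)$ with $x=1/(1-z)$. Then $$b_n=-\Gamma(n)\,U(n,0,1).$$
   Context: $E_1(x):=\int_x^\infty \frac{e^{-t}}{t}\,dt$ is the exponential integral (principal branch; for $|z|<1$ the point $x=1/(1-z)$ lies in the right half-plane). The function $f_1$ is analytic in the open unit disk $\{z\in\mathbb{C}:|z|<1\}$, and $[z^n]f_1(z)$ denotes the coefficient of $z^n$ in its Maclaurin series. $U(a,b,z)$ is Tricomi's confluent hypergeometric function (the standard minimal second solution of Kummer's equation $zw''+(b-z)w'-aw=0$), given for $\Re(a)>0$, $\Re(z)>0$ by $$U(a,b,z)=\frac{1}{\Gamma(a)}\int_0^\infty e^{-zt}\,t^{a-1}(1+t)^{b-a-1}\,dt.$$ *)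

(* Defs.v *)
From Stdlib Require Import Reals ClassicalEpsilon.
From Coquelicot Require Import Coquelicot.

Open Scope C_scope.

Definition Cexp (z : C) : C :=
  (exp (fst z) * cos (snd z), exp (fst z) * sin (snd z))%R.

(* [t ^ a] for real [t > 0] and complex [a]; only meaningful for [0 < t]. *)
Definition Rcpow (t : R) (a : C) : C := Cexp (a * RtoC (ln t)).

Definition CRInt_gen (f : R -> C) (Fa Fb : (R -> Prop) -> Prop) : C :=
  @RInt_gen C_R_CompleteNormedModule f Fa Fb.

(* The path from [x] to infinity is the horizontal ray [t = x + s], [s >= 0].
   When [Re x > 0] it stays in the right half-plane, away from the branch cut
   [(-oo, 0]], so this is the principal branch. *)
Definition E1 (x : C) : C :=
  CRInt_gen (fun s : R => Cexp (- (x + RtoC s)) / (x + RtoC s))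
    (at_point 0%R) (Rbar_locally p_infty).

(* Euler's integral, for [Re a > 0]. *)
Definition CGamma (a : C) : C :=
  CRInt_gen (fun t : R => Rcpow t (a - 1) * Cexp (- RtoC t))
    (at_right 0%R) (Rbar_locally p_infty).

(* For [Re a > 0] and [Re z > 0]. *)
Definition tricomiU (a b z : C) : C :=
  / CGamma a *
  CRInt_gen
    (fun t : R => Cexp (- (z * RtoC t)) * Rcpow t (a - 1)
                  * Rcpow (1 + t) (b - a - 1))
    (at_right 0%R) (Rbar_locally p_infty).

Definition is_maclaurin_series (f : C -> C) (c : nat -> C) : Prop :=
  forall z : C, (Cmod z < 1)%R ->
    @is_pseries C_AbsRing C_NormedModule c z (f z).

(* [[z^n] f] for [f] analytic in the open unit disk.  The expansion is unique
   when it exists, so the description operator makes no actual choice; if [f]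
   has no such expansion the value is unspecified. *)
Definition maclaurin_coef (f : C -> C) : nat -> C :=
  epsilon (inhabits (fun _ : nat => RtoC 0)) (is_maclaurin_series f).

Definition f1 (z : C) : C :=
  let x := 1 / (1 - z) in Cexp x * E1 x.

(* Main.v *)
Require Import Defs.
From Stdlib Require Import Reals Lra Lia Factorial ClassicalEpsilon.
From Coquelicot Require Import Coquelicot.

(** Moving the factor [e^x] inside the exponential integral turns [f1] into
    [f1 z = int_0^oo e^(-s) / (x + s) ds] with [x = 1 / (1 - z)], that is
    [int_0^oo e^(-s) (1 - z) / (1 + s (1 - z)) ds].  In terms of
    [w = s / (1 + s)] the rational factor is
    [(1 - z) / ((1 + s) (1 - w z))], a geometric series in [w z] whose
    [k]-th Taylor coefficient in [z], for [k >= 1], is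
    [(w^k - w^(k-1)) / (1 + s) = - s^(k-1) / (1 + s)^(k+1)].  Integrated
    against [e^(-s)] this is minus the integral that defines
    [Gamma(k) U(k, 0, 1)].

    Sum and integral may be exchanged because the Taylor remainder of the
    integrand is explicit (lemma [f1_kernel_remainder]):
    [- z^(N+1) e^(-s) s^N / ((1 + s)^(N+1) (1 + s (1 - z)))].  The last factor
    of the denominator has real part at least [1] on the unit disk, so the
    integrated remainder is at most [|z|^(N+1)] (lemma
    [Cmod_f1_remainder_le]).  This proves that the coefficients above form a
    Maclaurin series of [f1]; such a series is unique because its real and
    imaginary parts are determined on the real interval (-1, 1) (lemma
    [is_maclaurin_series_unique]).

    The factor [Gamma(n)] of the statement cancels the [1 / Gamma(n)] in the
    definition of [U] only because [Gamma(n) = (n-1)!] is nonzero, which is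
    lemma [CGamma_S].

    Improper integrals being limits, each of them has to be shown to converge:
    Euler's has an explicit primitive, and the others are dominated by a multiple
    of [e^(-s)] (lemma [ex_RInt_gen_dominated]). *)

Open Scope C_scope.

(** * Improper integrals of vector-valued functions *)

Section Linear.
Context {U V : NormedModule R_AbsRing} (L : U -> V) (HL : is_linear L).

Lemma Riemann_sum_linear (f : R -> U) (s : @SF_seq R) :
  Riemann_sum (fun t => L (f t)) s = L (Riemann_sum f s).
Proof.
  apply (SF_cons_ind (fun s => Riemann_sum (fun t => L (f t)) s
                               = L (Riemann_sum f s))).
  - intros x0. unfold Riemann_sum; simpl. symmetry. apply (linear_zero L HL).
  - intros h s' IH. rewrite !Riemann_sum_cons, IH.
    rewrite (linear_plus L HL), (linear_scal L HL). reflexivity.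
Qed.

(** Riemann sums commute with linear maps and continuous linear maps preserve
    limits.  Applied to the embedding of [R] in [C] and to multiplication by a
    complex constant, neither of which is a scaling of real modules. *)
Lemma is_RInt_linear (f : R -> U) (a b : R) (l : U) :
  is_RInt f a b l -> is_RInt (fun t => L (f t)) a b (L l).
Proof.
  intros H. unfold is_RInt.
  apply (filterlim_ext (fun s => L (scal (sign (b - a)) (Riemann_sum f s)))).
  - intros s. rewrite Riemann_sum_linear. apply (linear_scal L HL).
  - eapply filterlim_comp; [exact H | exact (linear_cont L l HL)].
Qed.

Lemma is_RInt_gen_linear (Fa Fb : (R -> Prop) -> Prop)
  {FFa : Filter Fa} {FFb : Filter Fb} (f : R -> U) (l : U) :
  is_RInt_gen f Fa Fb l -> is_RInt_gen (fun t => L (f t)) Fa Fb (L l).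
Proof.
  intros H P HP.
  generalize (H (fun y => P (L y)) (linear_cont L l HL P HP)).
  unfold filtermapi. apply filter_imp.
  intros ab (y & Hy & Py). exists (L y). split; [now apply is_RInt_linear | exact Py].
Qed.
End Linear.

(** For [a <= b <= c] the difference of the integrals of [f] up to [c] and up to
    [b] is its integral over [[b, c]], whose norm is at most the same difference
    for [g].  Hence the Cauchy criterion passes from [g] to [f]. *)
Lemma ex_RInt_gen_dominated {V : CompleteNormedModule R_AbsRing}
  (f : R -> V) (g : R -> R) (a lg : R) :
  (forall t, (a <= t)%R -> continuous f t) ->
  (forall t, (a <= t)%R -> (norm (f t) <= g t)%R) ->
  is_RInt_gen g (at_point a) (Rbar_locally p_infty) lg ->
  ex_RInt_gen f (at_point a) (Rbar_locally p_infty).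
Proof.
  intros Hc Hle Hg.
  assert (Hex : forall b c, (a <= b)%R -> (a <= c)%R -> ex_RInt f b c).
  { intros b c Hb Hbc. apply ex_RInt_continuous. intros z [Hz _]. apply Hc.
    eapply Rle_trans; [|exact Hz]. now apply Rmin_glb. }
  refine (proj1 (@filterlimi_locally_cauchy _ V
    (filter_prod (at_point a) (Rbar_locally p_infty)) _
    (fun ab => is_RInt f (fst ab) (snd ab)) _) _).
  - exists (fun x => x = a) (fun y => (a < y)%R).
    + reflexivity.
    + exists a. easy.
    + intros x y -> Hy. split.
      * apply (Hex a y); simpl; lra.
      * intros y1 y2 H1 H2.
        transitivity (RInt f a y); [symmetry|]; now apply is_RInt_unique.
  - intros eps.
    set (P := fun ab : R * R => exists y, is_RInt g (fst ab) (snd ab) y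
              /\ ball lg (pos_div_2 eps) y).
    exists (fun ab => P ab /\ fst ab = a /\ (a <= snd ab)%R).
    split.
    + apply filter_and; [exact (Hg _ (locally_ball lg (pos_div_2 eps)))|].
      exists (fun x => x = a) (fun y => (a < y)%R); [reflexivity | now exists a |].
      simpl; intros x y -> Hy; split; [reflexivity|lra].
    + assert (Hmain : forall b c u' v', (a <= b <= c)%R -> P (a, b) -> P (a, c) ->
          is_RInt f a b u' -> is_RInt f a c v' -> (norm (minus v' u') < eps)%R).
      { intros b c u' v' [Hab Hbc] (gb & Gb & Bb) (gc & Gc & Bc) Hu Hv.
        simpl in Gb, Gc.
        assert (Hf : is_RInt f b c (minus v' u')).
        { replace (minus v' u') with (plus (opp u') v')
            by (unfold minus; apply plus_comm).
          apply (is_RInt_Chasles f b a c); [now apply is_RInt_swap | exact Hv]. }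
        assert (Hgbc : is_RInt g b c (minus gc gb)).
        { replace (minus gc gb) with (plus (opp gb) gc)
            by (unfold minus; apply plus_comm).
          apply (is_RInt_Chasles g b a c); [now apply is_RInt_swap | exact Gc]. }
        apply Rle_lt_trans with (minus gc gb : R).
        - eapply norm_RInt_le; [exact Hbc | | exact Hf | exact Hgbc].
          intros x Hx. apply Hle. lra.
        - apply Rabs_lt_between in Bb. apply Rabs_lt_between in Bc.
          unfold minus, plus, opp in *; simpl in *. lra. }
      intros [a1 b] [a2 c] (Pb & Ea1 & Hb) (Pc & Ea2 & Hc') u' v' Hu Hv.
      simpl in *. subst a1 a2.
      apply (@norm_compat1 _ V).
      destruct (Rle_dec b c) as [Hbc | Hbc].
      * now apply (Hmain b c u' v').
      * rewrite <- norm_opp, opp_minus. apply (Hmain c b v' u'); auto; lra.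
Qed.

(** Continuity at [a] bounds [f] near [a], so the integral of [f] over a short
    interval starting at [a] is small.  This reconciles integrals that start at
    the endpoint, such as [E1], with those that approach it, such as Euler's
    and Tricomi's. *)
Lemma is_RInt_gen_at_right {V : CompleteNormedModule R_AbsRing}
  (Fb : (R -> Prop) -> Prop) {FFb : Filter Fb} (f : R -> V) (a : R) (l : V) :
  (forall t, (a <= t)%R -> continuous f t) ->
  is_RInt_gen f (at_point a) Fb l -> is_RInt_gen f (at_right a) Fb l.
Proof.
  intros Hc Hl. rewrite <- (plus_zero_l l).
  apply (@is_RInt_gen_Chasles V (at_right a) Fb _ _ f a zero l); [|exact Hl].
  pose proof (Hc a (Rle_refl a)) as Ha.
  destruct (Ha _ (locally_ball (f a) (mkposreal 1 Rlt_0_1))) as [d Hd].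
  set (M := (norm (f a) + @norm_factor _ V)%R).
  assert (HM : (0 < M)%R).
  { unfold M. pose proof (norm_ge_0 (f a)). pose proof (@norm_factor_gt_0 _ V). lra. }
  assert (HfM : forall t, (a <= t < a + d)%R -> (norm (f t) <= M)%R).
  { intros t Ht. assert (B : ball a d t).
    { apply Rabs_lt_between. unfold minus, plus, opp; simpl.
      pose proof (cond_pos d); lra. }
    apply Hd in B. apply (@norm_compat2 _ V) in B. simpl in B.
    replace (f t) with (plus (minus (f t) (f a)) (f a)).
    - eapply Rle_trans; [apply (@norm_triangle _ V)|].
      unfold M. rewrite Rplus_comm. apply Rplus_le_compat_l.
      rewrite Rmult_1_r in B. now apply Rlt_le.
    - unfold minus. now rewrite <- plus_assoc, plus_opp_l, plus_zero_r. }
  intros P [eps HP].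
  assert (Hdel : (0 < Rmin d (eps / M))%R).
  { apply Rmin_pos; [apply cond_pos | apply Rdiv_lt_0_compat; [apply cond_pos|exact HM]]. }
  exists (fun x => (a < x < a + Rmin d (eps / M))%R) (fun y => y = a).
  - exists (mkposreal _ Hdel). intros y Hy Hay. apply Rabs_lt_between in Hy.
    unfold minus, plus, opp in Hy; simpl in *. lra.
  - reflexivity.
  - intros x y Hx ->. simpl.
    pose proof (Rmin_l d (eps / M)); pose proof (Rmin_r d (eps / M)).
    destruct (ex_RInt_continuous f a x) as [I HI].
    { intros z Hz. apply Hc. rewrite Rmin_left in Hz; lra. }
    exists (opp I). split; [now apply is_RInt_swap|].
    apply HP, (@norm_compat1 _ V).
    eapply Rle_lt_trans.
    { apply Req_le. transitivity (norm (opp I)).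
      - apply f_equal. exact (@minus_zero_r V (opp I)).
      - exact (@norm_opp _ V I). }
    apply Rle_lt_trans with (scal (x - a)%R M).
    + eapply (norm_RInt_le f (fun _ => M) a x);
        [lra | | exact HI | exact (@is_RInt_const R_NormedModule a x M)].
      intros t Ht. apply HfM. lra.
    + unfold scal; simpl; unfold mult; simpl.
      replace (pos eps) with (eps / M * M)%R by (field; lra).
      apply Rmult_lt_compat_r; lra.
Qed.

(** In the form expected by [is_RInt_gen_ext]: two integrands need only agree on
    the half-line of integration. *)
Lemma filter_prod_half_line (a : R) (P : R -> Prop) :
  (forall s, (a <= s)%R -> P s) ->
  filter_prod (at_point a) (Rbar_locally p_infty) (fun ab =>
    forall s, (Rmin (fst ab) (snd ab) < s < Rmax (fst ab) (snd ab))%R -> P s).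
Proof.
  intros HP. exists (fun x => x = a) (fun y => (a < y)%R); [reflexivity | now exists a |].
  simpl. intros x y -> Hy s [Hs _]. apply HP. rewrite Rmin_left in Hs; lra.
Qed.

Lemma filter_prod_right_half_line (P : R -> Prop) :
  (forall s, (0 < s)%R -> P s) ->
  filter_prod (at_right 0%R) (Rbar_locally p_infty) (fun ab =>
    forall s, (Rmin (fst ab) (snd ab) < s < Rmax (fst ab) (snd ab))%R -> P s).
Proof.
  intros HP. exists (fun x => (0 < x)%R) (fun y => (0 < y)%R).
  - exists (mkposreal 1 Rlt_0_1). now intros y _ Hy.
  - now exists 0%R.
  - simpl. intros x y Hx Hy s [Hs _]. apply HP.
    eapply Rlt_trans; [|exact Hs]. now apply Rmin_glb_lt.
Qed.

(** * The integrals of t^k e^(-t) *)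

(** With [c = k + 1], the bound [u e^(-u) <= 1] at [u = t / c], raised to the
    power [c], gives [t^c e^(-t) <= c^c]; divide by [t]. *)
Lemma is_lim_pow_exp (k : nat) :
  is_lim (fun t => t ^ k * exp (- t))%R p_infty 0%R.
Proof.
  set (c := INR (S k)).
  assert (Hc : (0 < c)%R) by (apply lt_0_INR; lia).
  apply is_lim_le_le_loc with (fun _ => 0%R) (fun t => c ^ S k * / t)%R.
  - exists 0%R. intros t Ht.
    assert (E : exp (- t) = (exp (- (t / c)) ^ S k)%R).
    { rewrite <- Rpower_pow by apply exp_pos. unfold Rpower. rewrite ln_exp.
      f_equal. fold c. field. lra. }
    pose proof (pow_lt t k Ht). pose proof (exp_pos (- t)).
    split; [apply Rlt_le, Rmult_lt_0_compat; assumption|].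
    assert (B : (t / c * exp (- (t / c)) <= 1)%R).
    { rewrite exp_Ropp. pose proof (exp_ineq1_le (t / c)).
      pose proof (exp_pos (t / c)).
      apply Rmult_le_reg_r with (exp (t / c)); [assumption|].
      rewrite Rmult_assoc, Rinv_l by lra. lra. }
    apply Rmult_le_reg_r with t; [assumption|].
    replace (c ^ S k * / t * t)%R with (c ^ S k * 1)%R by (field; lra).
    replace (t ^ k * exp (- t) * t)%R
      with (c ^ S k * (t / c * exp (- (t / c))) ^ S k)%R.
    + apply Rmult_le_compat_l; [apply pow_le; lra|].
      rewrite <- (pow1 (S k)). apply pow_incr. split; [|exact B].
      apply Rmult_le_pos; [apply Rdiv_le_0_compat; lra | apply Rlt_le, exp_pos].
    + rewrite <- Rpow_mult_distr.
      replace (c * (t / c * exp (- (t / c))))%R with (t * exp (- (t / c)))%R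
        by (field; lra).
      rewrite Rpow_mult_distr, <- E. simpl. ring.
  - apply is_lim_const.
  - replace (Finite 0) with (Rbar_mult (c ^ S k)%R (Rbar_inv p_infty))
      by (simpl; now rewrite Rmult_0_r).
    apply is_lim_scal_l, is_lim_inv; [apply is_lim_id | easy].
Qed.

(** Repeated integration by parts of [t^k e^(-t)]. *)
Fixpoint pow_exp_primitive (k : nat) (t : R) : R :=
  match k with
  | O => - exp (- t)
  | S j => - (t ^ S j * exp (- t)) + INR (S j) * pow_exp_primitive j t
  end%R.

Lemma is_derive_pow_exp_primitive (k : nat) (t : R) :
  is_derive (pow_exp_primitive k) t (t ^ k * exp (- t))%R.
Proof.
  induction k as [|j IH].
  - cbn [pow_exp_primitive]. auto_derive; [easy | simpl; ring].
  - cbn [pow_exp_primitive].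
    replace (t ^ S j * exp (- t))%R with
      (plus (- (INR (S j) * t ^ j * exp (- t)) + t ^ S j * exp (- t))
            (INR (S j) * (t ^ j * exp (- t))))%R
      by (unfold plus; simpl; ring).
    apply (is_derive_plus (V := R_NormedModule)).
    + auto_derive; [easy|].
      change (match j with O => 1 | S _ => INR j + 1 end)%R with (INR (S j)).
      simpl pow. ring.
    + now apply is_derive_scal.
Qed.

Lemma pow_exp_primitive_0 (k : nat) : pow_exp_primitive k 0 = (- INR (fact k))%R.
Proof.
  induction k as [|j IH].
  - simpl. rewrite Ropp_0, exp_0. ring.
  - cbn [pow_exp_primitive]. rewrite IH, fact_simpl, mult_INR. simpl pow. ring.
Qed.

Lemma is_lim_pow_exp_primitive (k : nat) :
  is_lim (pow_exp_primitive k) p_infty 0%R.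
Proof.
  induction k as [|j IH]; cbn [pow_exp_primitive].
  - apply is_lim_ext with (fun t => - (t ^ 0 * exp (- t)))%R.
    { intros t. simpl. ring. }
    replace (Finite 0) with (Rbar_opp 0%R) by (simpl; now rewrite Ropp_0).
    apply is_lim_opp, is_lim_pow_exp.
  - replace (Finite 0) with (Finite (- 0 + INR (S j) * 0))%R by (f_equal; ring).
    apply is_lim_plus'; [apply (is_lim_opp _ _ 0%R), is_lim_pow_exp|].
    now apply (is_lim_scal_l _ _ _ 0%R).
Qed.

(** The primitive vanishes at infinity and is [- k!] at [0].  The lower end is an
    arbitrary filter finer than the neighbourhoods of [0], to cover both a lower
    bound equal to [0] and one tending to [0] from the right. *)
Lemma is_RInt_gen_pow_exp (Fa : (R -> Prop) -> Prop) {FFa : Filter Fa} (k : nat) :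
  filter_le Fa (locally 0%R) ->
  is_RInt_gen (fun t => t ^ k * exp (- t))%R Fa (Rbar_locally p_infty)
    (INR (fact k)).
Proof.
  intros HFa.
  assert (HD : forall t, Derive (pow_exp_primitive k) t = (t ^ k * exp (- t))%R).
  { intros t. apply is_derive_unique, is_derive_pow_exp_primitive. }
  apply is_RInt_gen_ext with (Derive (pow_exp_primitive k)).
  { apply filter_forall. intros ab x _. apply HD. }
  replace (INR (fact k)) with (0 - pow_exp_primitive k 0)%R
    by (rewrite pow_exp_primitive_0; ring).
  apply is_RInt_gen_Derive.
  - apply filter_forall. intros ab x _. eexists. apply is_derive_pow_exp_primitive.
  - apply filter_forall. intros ab x _.
    apply continuous_ext with (fun t => t ^ k * exp (- t))%R; [easy|].
    apply (ex_derive_continuous (V := R_NormedModule)). now auto_derive.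
  - apply filterlim_filter_le_1 with (1 := HFa).
    apply (ex_derive_continuous (V := R_NormedModule)).
    eexists. apply is_derive_pow_exp_primitive.
  - apply is_lim_pow_exp_primitive.
Qed.

Lemma is_RInt_gen_exp :
  is_RInt_gen (fun t => exp (- t)) (at_point 0%R) (Rbar_locally p_infty) 1%R.
Proof.
  apply is_RInt_gen_ext with (fun t => t ^ 0 * exp (- t))%R.
  { apply filter_forall. intros ab x _. simpl. ring. }
  apply (is_RInt_gen_pow_exp (at_point 0%R) 0).
  intros P HP. exact (locally_singleton _ _ HP).
Qed.

(** * Complex-valued integrands *)

(** The norm of [C] as a real normed module is that of a product of two copies of
    [R], which is the modulus but not by definition. *)
Lemma norm_C_R (z : C) : @norm R_AbsRing C_R_NormedModule z = Cmod z.
Proof.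
  unfold norm; simpl. unfold prod_norm, norm; simpl. unfold Cmod, abs; simpl.
  f_equal. rewrite !Rmult_1_r, <- !Rabs_mult.
  rewrite !Rabs_pos_eq by apply Rle_0_sqr. reflexivity.
Qed.

Lemma is_linear_RtoC :
  is_linear (U := R_NormedModule) (V := C_R_NormedModule) RtoC.
Proof.
  split.
  - intros x y. exact (RtoC_plus x y).
  - intros k x. unfold scal; simpl. unfold prod_scal, RtoC; simpl.
    apply injective_projections; simpl; [reflexivity|]. unfold scal, mult; simpl.
    unfold mult; simpl. ring.
  - exists 1%R. split; [lra|]. intros x. rewrite norm_C_R, Cmod_R.
    unfold norm; simpl. unfold abs; simpl. lra.
Qed.

Lemma is_linear_Cmult (c : C) :
  is_linear (U := C_R_NormedModule) (V := C_R_NormedModule) (Cmult c).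
Proof.
  split.
  - intros x y. exact (Cmult_plus_distr_l c x y).
  - intros k x. unfold scal; simpl. unfold prod_scal, scal; simpl.
    unfold mult; simpl. apply injective_projections; simpl; ring.
  - exists (Cmod c + 1)%R. split; [pose proof (Cmod_ge_0 c); lra|].
    intros x. rewrite !norm_C_R, Cmod_mult.
    apply Rmult_le_compat_r; [apply Cmod_ge_0 | lra].
Qed.

Lemma Cexp_plus (a b : C) : Cexp (a + b) = Cexp a * Cexp b.
Proof.
  unfold Cexp. apply injective_projections; simpl;
    rewrite exp_plus, ?cos_plus, ?sin_plus; ring.
Qed.

Lemma Cexp_RtoC (r : R) : Cexp (RtoC r) = RtoC (exp r).
Proof.
  unfold Cexp, RtoC; simpl. rewrite cos_0, sin_0. f_equal; ring.
Qed.

Lemma Cexp_opp_r (a : C) : Cexp a * Cexp (- a) = 1.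
Proof.
  rewrite <- Cexp_plus, Cplus_opp_r, Cexp_RtoC, exp_0. reflexivity.
Qed.

Lemma Rcpow_INR (t : R) (k : nat) (a : C) :
  (0 < t)%R -> a = RtoC (INR k) -> Rcpow t a = RtoC (t ^ k).
Proof.
  intros Ht ->. unfold Rcpow. rewrite <- RtoC_mult, Cexp_RtoC. f_equal.
  exact (Rpower_pow k t Ht).
Qed.

Lemma CGamma_S (j : nat) : CGamma (RtoC (INR (S j))) = RtoC (INR (fact j)).
Proof.
  unfold CGamma, CRInt_gen.
  apply (is_RInt_gen_unique (V := C_R_CompleteNormedModule)).
  apply (is_RInt_gen_ext (V := C_R_NormedModule) (fun t => RtoC (t ^ j * exp (- t)))).
  - apply filter_prod_right_half_line. intros t Ht.
    rewrite (Rcpow_INR t j) by (try exact Ht; rewrite S_INR, RtoC_plus; ring).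
    now rewrite RtoC_mult, <- RtoC_opp, Cexp_RtoC.
  - apply (is_RInt_gen_linear RtoC is_linear_RtoC _ _ _ _).
    apply (is_RInt_gen_pow_exp (at_right 0%R) j).
    intros P HP. unfold at_right, within. revert HP. now apply filter_imp.
Qed.

(** * Complex power series *)

(** Typed in [C] itself, so that it serves both for series over the complex field
    and for integrands in the real normed module [C]. *)
Definition partial_sum (c : nat -> C) (z : C) (N : nat) : C :=
  @sum_n C_AbelianMonoid (fun k => pow_n (K := C_Ring) z k * c k) N.

Lemma partial_sum_0 c z : partial_sum c z 0 = c O.
Proof. unfold partial_sum. rewrite sum_O. simpl. apply Cmult_1_l. Qed.

Lemma partial_sum_S c z N :
  partial_sum c z (S N) = partial_sum c z N + pow_n (K := C_Ring) z (S N) * c (S N).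
Proof. exact (@sum_Sn C_AbelianMonoid _ N). Qed.

Lemma Cmod_pow_n (z : C) (k : nat) : Cmod (pow_n (K := C_Ring) z k) = (Cmod z ^ k)%R.
Proof.
  induction k as [|k IH]; [apply Cmod_1|].
  change (pow_n (K := C_Ring) z (S k)) with (z * pow_n (K := C_Ring) z k).
  rewrite Cmod_mult, IH. reflexivity.
Qed.

(** Convergence at [1/2] makes the radius of convergence positive, and a power
    series with positive radius is determined by its sum near [0]. *)
Lemma is_pseries_zero_coef (d : nat -> R) :
  (forall x : R, (Rabs x < 1)%R -> is_pseries d x 0%R) -> forall n, d n = 0%R.
Proof.
  intros H n.
  assert (Hr : Rbar_lt 0%R (CV_radius d)).
  { apply Rbar_not_le_lt. intros Hle.
    apply (CV_disk_outside d (1/2)%R).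
    - eapply Rbar_le_lt_trans; [exact Hle|]. simpl. rewrite Rabs_pos_eq; lra.
    - apply ex_series_lim_0. exists 0%R.
      eapply is_series_ext; [|apply (H (1/2)%R); rewrite Rabs_pos_eq; lra].
      intros k. unfold scal; simpl. unfold mult; simpl. rewrite pow_n_pow. ring. }
  apply (PSeries_ext_recip d (fun _ => 0%R) n).
  - exact Hr.
  - rewrite CV_radius_const_0. easy.
  - exists (mkposreal 1 Rlt_0_1). intros x Hx.
    rewrite PSeries_const_0. apply is_pseries_unique, H.
    apply Rabs_lt_between. apply Rabs_lt_between in Hx.
    unfold minus, plus, opp in Hx; simpl in Hx. lra.
Qed.

Lemma is_pseries_RtoC (c : nat -> C) (x : R) (l : C) :
  @is_pseries C_AbsRing C_NormedModule c (RtoC x) l ->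
  is_pseries (fun k => fst (c k)) x (fst l) /\
  is_pseries (fun k => snd (c k)) x (snd l).
Proof.
  intros H.
  assert (Hp : forall k, pow_n (K := C_Ring) (RtoC x) k = RtoC (pow_n (K := R_Ring) x k)).
  { induction k as [|k IH]; [reflexivity|].
    change (pow_n (K := C_Ring) (RtoC x) (S k)) with (RtoC x * pow_n (K := C_Ring) (RtoC x) k).
    rewrite IH, <- RtoC_mult. reflexivity. }
  assert (HS : forall N, partial_sum c (RtoC x) N
    = (sum_n (fun k => scal (pow_n (K := R_Ring) x k) (fst (c k))) N,
       sum_n (fun k => scal (pow_n (K := R_Ring) x k) (snd (c k))) N)).
  { induction N as [|N IH].
    - rewrite partial_sum_0, !sum_O. unfold scal; simpl. unfold mult, one; simpl.
      rewrite !Rmult_1_l. apply surjective_pairing.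
    - rewrite partial_sum_S, IH, !sum_Sn, Hp.
      apply injective_projections; unfold plus, scal, mult; simpl;
      unfold mult; simpl; ring. }
  split.
  - apply (filterlim_ext (fun N => fst (partial_sum c (RtoC x) N))).
    { intros N. now rewrite HS. }
    eapply filterlim_comp; [exact H|]. destruct l. apply continuous_fst.
  - apply (filterlim_ext (fun N => snd (partial_sum c (RtoC x) N))).
    { intros N. now rewrite HS. }
    eapply filterlim_comp; [exact H|]. destruct l. apply continuous_snd.
Qed.

(** Restriction to real [z] reduces the question to two real power series, the real
    and the imaginary part of the difference. *)
Lemma is_maclaurin_series_unique (f : C -> C) (c d : nat -> C) :
  is_maclaurin_series f c -> is_maclaurin_series f d -> forall n, c n = d n.
Proof.
  intros Hc Hd n.
  assert (H : forall x : R, (Rabs x < 1)%R ->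
    is_pseries (fun k => fst (c k) - fst (d k))%R x 0%R /\
    is_pseries (fun k => snd (c k) - snd (d k))%R x 0%R).
  { intros x Hx. rewrite <- Cmod_R in Hx.
    destruct (is_pseries_RtoC _ _ _ (Hc _ Hx)) as [C1 C2].
    destruct (is_pseries_RtoC _ _ _ (Hd _ Hx)) as [D1 D2].
    split.
    - rewrite <- (Rplus_opp_r (fst (f (RtoC x)))).
      exact (is_pseries_minus _ _ _ _ _ C1 D1).
    - rewrite <- (Rplus_opp_r (snd (f (RtoC x)))).
      exact (is_pseries_minus _ _ _ _ _ C2 D2). }
  apply injective_projections; apply Rminus_diag_uniq.
  - exact (is_pseries_zero_coef _ (fun x Hx => proj1 (H x Hx)) n).
  - exact (is_pseries_zero_coef _ (fun x Hx => proj2 (H x Hx)) n).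
Qed.

(** * The integral representation of f1 *)

(** This is [e^(-s) / (x + s)] with [x = 1 / (1 - z)]. *)
Definition f1_kernel (z : C) (s : R) : C :=
  RtoC (exp (- s)) * ((1 - z) / (1 + RtoC s * (1 - z))).

Lemma Re_lt_1 (z : C) : (Cmod z < 1)%R -> (fst z < 1)%R.
Proof.
  intros Hz. pose proof (re_le_Cmod z). pose proof (Rle_abs (fst z)).
  unfold Re in *. lra.
Qed.

(** The real part is [1 + s (1 - Re z)] and [Re z < 1]. *)
Lemma f1_kernel_denominator_ge_1 (z : C) (s : R) :
  (Cmod z < 1)%R -> (0 <= s)%R -> (1 <= Cmod (1 + RtoC s * (1 - z)))%R.
Proof.
  intros Hz Hs. apply Re_lt_1 in Hz.
  eapply Rle_trans; [|apply re_le_Cmod]. eapply Rle_trans; [|apply Rle_abs].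
  unfold Re; simpl. assert (0 <= s * (1 - fst z))%R by (apply Rmult_le_pos; lra). lra.
Qed.

Lemma f1_kernel_denominator_neq_0 (z : C) (s : R) :
  (Cmod z < 1)%R -> (0 <= s)%R -> 1 + RtoC s * (1 - z) <> 0.
Proof.
  intros Hz Hs. apply Cmod_gt_0.
  pose proof (f1_kernel_denominator_ge_1 z s Hz Hs). lra.
Qed.

Lemma continuous_f1_kernel (z : C) (s : R) :
  (Cmod z < 1)%R -> (0 <= s)%R ->
  continuous (U := C_R_NormedModule) (f1_kernel z) s.
Proof.
  intros Hz Hs. apply Re_lt_1 in Hz. destruct z as [a b]; simpl in Hz.
  set (q := fun t : R => ((1 + t * (1 - a)) ^ 2 + (t * b) ^ 2)%R).
  assert (Hq : q s <> 0%R).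
  { unfold q. assert (0 <= s * (1 - a))%R by (apply Rmult_le_pos; lra). nra. }
  (* Real and imaginary parts after multiplying by the conjugate denominator. *)
  apply continuous_ext with (fun t : R =>
    ((exp (- t) * ((1 - a) * (1 + t * (1 - a)) + b * b * t) / q t,
      exp (- t) * (- b) / q t)%R : C)).
  { intros t. unfold f1_kernel, Cdiv, Cinv, q.
    apply injective_projections; simpl; unfold Rdiv;
    replace (1 + (t * (1 + - a) - 0 * (0 + - b)))%R with (1 + t * (1 - a))%R by ring;
    replace (0 + (t * (0 + - b) + 0 * (1 + - a)))%R with (- (t * b))%R by ring;
    replace (- (t * b) * (- (t * b) * 1))%R with (t * b * (t * b * 1))%R by ring;
    ring. }
  unfold q in *.
  apply (continuous_comp_2 (W := R_UniformSpace) (V := R_UniformSpace)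
     (X := C_R_NormedModule) _ _ (fun x y => (x, y))).
  - apply (ex_derive_continuous (V := R_NormedModule)). now auto_derive.
  - apply (ex_derive_continuous (V := R_NormedModule)). now auto_derive.
  - apply continuous_ext with (fun p : R * R => p); [now intros [x y]|].
    apply continuous_id.
Qed.

Lemma Cmod_f1_kernel_le (z : C) (s : R) :
  (Cmod z < 1)%R -> (0 <= s)%R -> (Cmod (f1_kernel z s) <= 2 * exp (- s))%R.
Proof.
  intros Hz Hs. unfold f1_kernel.
  pose proof (f1_kernel_denominator_ge_1 z s Hz Hs) as Hd.
  rewrite Cmod_mult, Cmod_R, Rabs_pos_eq by apply Rlt_le, exp_pos.
  rewrite Rmult_comm. apply Rmult_le_compat_r; [apply Rlt_le, exp_pos|].
  rewrite Cmod_div by now apply f1_kernel_denominator_neq_0.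
  assert (Cmod (1 - z) <= 2)%R.
  { unfold Cminus. eapply Rle_trans; [apply Cmod_triangle|].
    rewrite Cmod_1, Cmod_opp. lra. }
  apply Rmult_le_reg_r with (Cmod (1 + RtoC s * (1 - z))); [lra|].
  unfold Rdiv. rewrite Rmult_assoc, Rinv_l by lra. lra.
Qed.

(** The integrand of [E1 x] is [Cexp (- x)] times the kernel, so the factor
    [Cexp x] in [f1] cancels. *)
Lemma is_RInt_gen_f1 (z : C) :
  (Cmod z < 1)%R ->
  is_RInt_gen (V := C_R_NormedModule) (f1_kernel z)
    (at_point 0%R) (Rbar_locally p_infty) (f1 z).
Proof.
  intros Hz.
  assert (Hex : ex_RInt_gen (V := C_R_CompleteNormedModule) (f1_kernel z)
                  (at_point 0%R) (Rbar_locally p_infty)).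
  { apply ex_RInt_gen_dominated with (fun s => scal 2%R (exp (- s)))
      (scal 2%R 1%R).
    - intros s Hs. now apply continuous_f1_kernel.
    - intros s Hs. eapply Rle_trans; [apply Req_le, norm_C_R|].
      now apply Cmod_f1_kernel_le.
    - apply (is_RInt_gen_scal (V := R_NormedModule)), is_RInt_gen_exp. }
  destruct Hex as [l Hl].
  assert (H1z : 1 - z <> 0).
  { intros E. apply Re_lt_1 in Hz. apply (f_equal fst) in E. simpl in E. lra. }
  set (x := 1 / (1 - z)).
  (* [Reals] has an unrelated [E1], a remainder of the exponential series. *)
  assert (HE : Defs.E1 x = (Cexp (- x) * l)%C).
  { unfold Defs.E1, CRInt_gen.
    apply (is_RInt_gen_unique (V := C_R_CompleteNormedModule)).
    apply (is_RInt_gen_ext (V := C_R_NormedModule)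
             (fun s => Cexp (- x) * f1_kernel z s)).
    - apply filter_prod_half_line. intros s Hs.
      pose proof (f1_kernel_denominator_neq_0 z s Hz Hs) as Hd.
      replace (- (x + RtoC s)) with (- x + RtoC (- s))
        by (rewrite RtoC_opp; ring).
      rewrite Cexp_plus, Cexp_RtoC. unfold f1_kernel, x.
      match goal with |- ?a = ?b => change (@eq C a b) end. field.
      repeat split; try assumption.
    - exact (is_RInt_gen_linear (Cmult (Cexp (- x))) (is_linear_Cmult _) _ _ _ _ Hl). }
  unfold f1. cbv zeta. fold x. rewrite HE, Cmult_assoc, Cexp_opp_r, Cmult_1_l.
  exact Hl.
Qed.

(** * The Maclaurin series of f1 *)

(** The Taylor coefficients of [f1_kernel z s] in the variable [z]. *)
Definition coef_kernel (k : nat) (s : R) : R :=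
  match k with
  | O => exp (- s) / (1 + s)
  | S j => - (exp (- s) * (s ^ j / (1 + s) ^ S (S j)))
  end%R.

Lemma pow_ratio_le_1 (j m : nat) (s : R) :
  (0 <= s)%R -> (j <= m)%nat -> (0 <= s ^ j / (1 + s) ^ m <= 1)%R.
Proof.
  intros Hs Hjm.
  assert (H1 : (0 < (1 + s) ^ m)%R) by (apply pow_lt; lra).
  split.
  - apply Rdiv_le_0_compat; [now apply pow_le | exact H1].
  - apply (proj1 (Rdiv_le_1 _ _ H1)).
    apply Rle_trans with ((1 + s) ^ j)%R; [apply pow_incr; lra|].
    apply Rle_pow; [lra | exact Hjm].
Qed.

Lemma continuous_coef_kernel (k : nat) (s : R) :
  (0 <= s)%R -> continuous (coef_kernel k) s.
Proof.
  intros Hs. apply (ex_derive_continuous (V := R_NormedModule)).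
  destruct k as [|j]; unfold coef_kernel; auto_derive; repeat split.
  - lra.
  - apply (pow_nonzero (1 + s) (S (S j))). lra.
Qed.

Lemma Rabs_coef_kernel_le (k : nat) (s : R) :
  (0 <= s)%R -> (Rabs (coef_kernel k s) <= exp (- s))%R.
Proof.
  intros Hs. pose proof (exp_pos (- s)) as He.
  assert (H : exists r, (0 <= r <= 1)%R /\
    Rabs (coef_kernel k s) = Rabs (exp (- s) * r)).
  { destruct k as [|j].
    - exists (s ^ 0 / (1 + s) ^ 1)%R. split; [apply pow_ratio_le_1; [lra|lia]|].
      f_equal. unfold coef_kernel. field. lra.
    - exists (s ^ j / (1 + s) ^ S (S j))%R. split; [apply pow_ratio_le_1; [lra|lia]|].
      apply Rabs_Ropp. }
  destruct H as (r & Hr & ->). rewrite Rabs_pos_eq by (apply Rmult_le_pos; lra).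
  nra.
Qed.

Definition f1_coef (k : nat) : R :=
  RInt_gen (V := R_CompleteNormedModule) (coef_kernel k)
    (at_point 0%R) (Rbar_locally p_infty).

(** The Taylor coefficients are bounded by [e^(-s)], as [s^j <= (1 + s)^m] for
    [j <= m]. *)
Lemma is_RInt_gen_f1_coef (k : nat) :
  is_RInt_gen (coef_kernel k) (at_point 0%R) (Rbar_locally p_infty) (f1_coef k).
Proof.
  apply (RInt_gen_correct (V := R_CompleteNormedModule)).
  apply ex_RInt_gen_dominated with (fun s => exp (- s)) 1%R.
  - apply continuous_coef_kernel.
  - apply Rabs_coef_kernel_le.
  - apply is_RInt_gen_exp.
Qed.

Lemma is_RInt_gen_partial_sum (z : C) (N : nat) :
  is_RInt_gen (V := C_R_NormedModule)
    (fun s => partial_sum (fun k => RtoC (coef_kernel k s)) z N)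
    (at_point 0%R) (Rbar_locally p_infty)
    (partial_sum (fun k => RtoC (f1_coef k)) z N).
Proof.
  assert (HR : forall k, is_RInt_gen (V := C_R_NormedModule)
    (fun s => RtoC (coef_kernel k s)) (at_point 0%R) (Rbar_locally p_infty)
    (RtoC (f1_coef k))).
  { intros k. exact (is_RInt_gen_linear RtoC is_linear_RtoC _ _ _ _
                       (is_RInt_gen_f1_coef k)). }
  induction N as [|N IH].
  - rewrite partial_sum_0. eapply is_RInt_gen_ext; [|exact (HR O)].
    apply filter_forall. intros ab s _. now rewrite partial_sum_0.
  - rewrite partial_sum_S. eapply is_RInt_gen_ext.
    2: { apply (is_RInt_gen_plus (V := C_R_NormedModule)); [exact IH|].
         exact (is_RInt_gen_linear _ (is_linear_Cmult (pow_n (K := C_Ring) z (S N)))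
                  _ _ _ _ (HR (S N))). }
    apply filter_forall. intros ab s _. now rewrite partial_sum_S.
Qed.

(** Induction on [N].  With [D = 1 + s (1 - z) = (1 + s) - s z] and
    [A = z^(N+1) e^(-s) s^N / (1 + s)^(N+2)], the remainder of order [N] is
    [- A (1 + s) / D], the next Taylor term is [- A], and
    [1 - (1 + s) / D = - s z / D]. *)
Lemma f1_kernel_remainder (z : C) (N : nat) (s : R) :
  (Cmod z < 1)%R -> (0 <= s)%R ->
  f1_kernel z s - partial_sum (fun k => RtoC (coef_kernel k s)) z N
  = - (pow_n (K := C_Ring) z (S N)
       * (RtoC (exp (- s) * (s ^ N / (1 + s) ^ S N))
          / (1 + RtoC s * (1 - z)))).
Proof.
  intros Hz Hs.
  pose proof (f1_kernel_denominator_neq_0 z s Hz Hs) as Hd.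
  assert (Hs1 : 1 + RtoC s <> 0).
  { intros E. apply (f_equal fst) in E. simpl in E. lra. }
  assert (Hp : forall m, RtoC ((1 + s) ^ m) <> 0).
  { intros m E. apply (f_equal fst) in E. simpl in E.
    assert (0 < (1 + s) ^ m)%R by (apply pow_lt; lra). lra. }
  assert (Hr : forall m, ((1 + s) ^ m)%R <> 0%R) by (intros m; apply pow_nonzero; lra).
  induction N as [|N IH].
  - rewrite partial_sum_0. unfold f1_kernel, coef_kernel. simpl pow_n.
    change (@mult C_Ring) with Cmult. change (@one C_Ring) with (RtoC 1).
    rewrite RtoC_div, RtoC_plus, RtoC_mult, RtoC_div by (simpl; lra).
    simpl pow. rewrite !Rmult_1_r, !RtoC_plus. field. now split.
  - rewrite partial_sum_S.
    replace (f1_kernel z s - (partial_sum (fun k => RtoC (coef_kernel k s)) z N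
        + pow_n (K := C_Ring) z (S N) * RtoC (coef_kernel (S N) s)))
      with ((f1_kernel z s - partial_sum (fun k => RtoC (coef_kernel k s)) z N)
        - pow_n (K := C_Ring) z (S N) * RtoC (coef_kernel (S N) s)) by ring.
    rewrite IH. unfold coef_kernel.
    change (pow_n (K := C_Ring) z (S (S N))) with (z * pow_n (K := C_Ring) z (S N)).
    replace (s ^ S N / (1 + s) ^ S (S N))%R
      with (s * (s ^ N / (1 + s) ^ S (S N)))%R by (simpl; field; repeat split; auto; lra).
    replace (s ^ N / (1 + s) ^ S N)%R
      with ((1 + s) * (s ^ N / (1 + s) ^ S (S N)))%R
      by (simpl; field; repeat split; auto; lra).
    generalize (s ^ N / (1 + s) ^ S (S N))%R as r. intros r.
    rewrite RtoC_opp, !RtoC_mult, RtoC_plus. field. exact Hd.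
Qed.

(** The integrand is at most [|z|^(N+1) e^(-s)], because [s^N <= (1 + s)^(N+1)] and
    [|1 + s (1 - z)| >= 1], and the integral of [e^(-s)] is [1]. *)
Lemma Cmod_f1_remainder_le (z : C) (N : nat) :
  (Cmod z < 1)%R ->
  (Cmod (f1 z - partial_sum (fun k => RtoC (f1_coef k)) z N) <= Cmod z ^ S N)%R.
Proof.
  intros Hz. rewrite <- norm_C_R, <- (Rmult_1_r (Cmod z ^ S N)).
  apply (RInt_gen_norm (V := C_R_CompleteNormedModule)
    (Fa := at_point 0%R) (Fb := Rbar_locally p_infty)
    (fun s => minus (G := C_R_NormedModule) (f1_kernel z s)
                (partial_sum (fun k => RtoC (coef_kernel k s)) z N))
    (fun s => scal (Cmod z ^ S N)%R (exp (- s)))).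
  - exists (fun x => x = 0%R) (fun y => (0 < y)%R); [reflexivity | now exists 0%R |].
    simpl. intros x y -> Hy. lra.
  - exists (fun x => x = 0%R) (fun y => (0 < y)%R); [reflexivity | now exists 0%R |].
    simpl. intros x y -> Hy s [Hs _].
    eapply Rle_trans; [apply Req_le, norm_C_R|].
    change (Cmod (f1_kernel z s - partial_sum (fun k => RtoC (coef_kernel k s)) z N)
            <= Cmod z ^ S N * exp (- s))%R.
    rewrite f1_kernel_remainder by assumption.
    pose proof (f1_kernel_denominator_ge_1 z s Hz Hs) as Hd.
    rewrite Cmod_opp, Cmod_mult, Cmod_pow_n, Cmod_div
      by now apply f1_kernel_denominator_neq_0.
    apply Rmult_le_compat_l; [apply pow_le, Cmod_ge_0|].
    pose proof (pow_ratio_le_1 N (S N) s Hs ltac:(lia)) as Hr.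
    pose proof (exp_pos (- s)) as He.
    rewrite Cmod_R, Rabs_pos_eq by (apply Rmult_le_pos; lra).
    apply Rmult_le_reg_r with (Cmod (1 + RtoC s * (1 - z))); [lra|].
    unfold Rdiv at 1. rewrite Rmult_assoc, Rinv_l by lra.
    rewrite Rmult_1_r. apply Rmult_le_compat_l; lra.
  - apply (is_RInt_gen_minus (V := C_R_NormedModule));
      [now apply is_RInt_gen_f1 | apply is_RInt_gen_partial_sum].
  - apply (is_RInt_gen_scal (V := R_NormedModule)), is_RInt_gen_exp.
Qed.

Lemma is_maclaurin_series_f1 : is_maclaurin_series f1 (fun k => RtoC (f1_coef k)).
Proof.
  intros z Hz. apply filterlim_locally. intros eps.
  assert (Hg : is_lim_seq (fun N => Cmod z ^ N)%R 0%R).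
  { apply is_lim_seq_geom. rewrite Rabs_pos_eq; [exact Hz | apply Cmod_ge_0]. }
  apply is_lim_seq_incr_1 in Hg.
  destruct (proj2 (is_lim_seq_spec _ _) Hg eps) as [N0 HN].
  exists N0. intros N HNN. specialize (HN N HNN).
  apply (@norm_compat1 C_AbsRing C_NormedModule).
  change (Cmod (partial_sum (fun k => RtoC (f1_coef k)) z N - f1 z) < eps)%R.
  rewrite <- Cmod_opp, Copp_minus_distr.
  eapply Rle_lt_trans; [now apply Cmod_f1_remainder_le|].
  eapply Rle_lt_trans; [apply Rle_abs|]. rewrite Rminus_0_r in HN. exact HN.
Qed.

Lemma maclaurin_coef_f1 (n : nat) : maclaurin_coef f1 n = RtoC (f1_coef n).
Proof.
  refine (is_maclaurin_series_unique f1 _ (fun k => RtoC (f1_coef k)) _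
            is_maclaurin_series_f1 n).
  exact (epsilon_spec _ _ (ex_intro _ _ is_maclaurin_series_f1)).
Qed.

(** At [n = j + 1], [a = n] and [b = 0] the exponents in Tricomi's integrand are
    [a - 1 = j] and [b - a - 1 = - (j + 2)], which makes it
    [- coef_kernel (j + 1)]. *)
Lemma tricomi_integral (j : nat) :
  CRInt_gen
    (fun t : R => Cexp (- (1 * RtoC t)) * Rcpow t (RtoC (INR (S j)) - 1)
                  * Rcpow (1 + t) (0 - RtoC (INR (S j)) - 1))
    (at_right 0%R) (Rbar_locally p_infty) = - RtoC (f1_coef (S j)).
Proof.
  apply (is_RInt_gen_unique (V := C_R_CompleteNormedModule)).
  rewrite <- RtoC_opp.
  apply (is_RInt_gen_ext (V := C_R_NormedModule)
           (fun t => RtoC (- coef_kernel (S j) t))).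
  - apply filter_prod_right_half_line. intros t Ht.
    rewrite (Rcpow_INR t j) by (try exact Ht; rewrite S_INR, RtoC_plus; ring).
    assert (E : Rcpow (1 + t) (0 - RtoC (INR (S j)) - 1)
                = RtoC (/ (1 + t) ^ S (S j))).
    { unfold Rcpow.
      replace (0 - RtoC (INR (S j)) - 1) with (RtoC (- INR (S (S j))))
        by (rewrite (S_INR (S j)), RtoC_opp, RtoC_plus; ring).
      rewrite <- RtoC_mult, Cexp_RtoC. f_equal.
      rewrite <- Rpower_pow by lra. apply Rpower_Ropp. }
    rewrite E, Cmult_1_l, <- RtoC_opp, Cexp_RtoC, <- !RtoC_mult.
    apply f_equal. unfold coef_kernel, Rdiv. ring.
  - apply (is_RInt_gen_linear RtoC is_linear_RtoC _ _ _ _).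
    apply (is_RInt_gen_opp (V := R_NormedModule)).
    apply (is_RInt_gen_at_right (V := R_CompleteNormedModule) (Rbar_locally p_infty)).
    + apply continuous_coef_kernel.
    + apply is_RInt_gen_f1_coef.
Qed.

Theorem lemma2 (n : nat) (hn : (1 <= n)%nat) :
  maclaurin_coef f1 n
  = - (CGamma (RtoC (INR n)) * tricomiU (RtoC (INR n)) 0 1).
Proof.
  destruct n as [|j]; [inversion hn|].
  rewrite maclaurin_coef_f1. unfold tricomiU.
  rewrite tricomi_integral, CGamma_S. field.
  intros E. apply (INR_fact_neq_0 j). now apply (f_equal fst) in E.
Qed.
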